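(* Suppose that $\mathrm{ahD}$ is strictly monotone for $P \in \mathcal P(\mathbb S^{d-1})$, and that $\{P_n\}_{n=1}^\infty \subset \mathcal P(\mathbb S^{d-1})$ is a sequence of measures that satisfies $$\lim_{n\to\infty} \sup_{x \in \mathbb S^{d-1}} \left| \mathrm{ahD}(x;P_n) - \mathrm{ahD}(x;P)\right| = 0.$$ Then for any closed interval $A \subset \left(\min_{x \in \mathbb S^{d-1}} \mathrm{ahD}(x;P), \max_{x \in \mathbb S^{d-1}} \mathrm{ahD}(x;P)\right)$, $$\lim_{n\to\infty} \sup_{\alpha \in A} \delta_H\left(\mathrm{ahD}_\alpha(P_n), \mathrm{ahD}_\alpha(P)\right) = 0.$$
   Context: Let $d \ge 2$ be an integer, $\mathbb S^{d-1} = \{x \in \mathbb R^d : \|x\| = 1\}$, and let $\mathcal P(\mathbb S^{d-1})$ be the set of Borel probability measures on $\mathbb S^{d-1}$. For a Borel set $A \subseteq \mathbb R^d$ and $P \in \mathcal P(\mathbb S^{d-1})$, write $P(A) = P(A \cap \mathbb S^{d-1})$. For $u \in \mathbb S^{d-1}$ let $H_{0,u} = \{y \in \mathbb R^d : \langle y,u\rangle \ge 0\}$. The angular halfspace depth is $$\mathrm{ahD}(x;P) = \inf\{P(H_{0,u}) : u \in \mathbb S^{d-1},\ x \in H_{0,u}\},\qquad x \in \mathbb S^{d-1},$$ and its central regions are the closed sets $\mathrm{ahD}_\alpha(P) = \{x \in \mathbb S^{d-1} : \mathrm{ahD}(x;P) \ge \alpha\}$. The depth $\mathrm{ahD}$ is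 strictly monotone for $P$ if for each $\alpha \in \left(\min_{x \in \mathbb S^{d-1}} \mathrm{ahD}(x;P), \max_{x \in \mathbb S^{d-1}} \mathrm{ahD}(x;P)\right)$ we have $$\mathrm{ahD}_\alpha(P) = \mathrm{cl}\left(\{x \in \mathbb S^{d-1} : \mathrm{ahD}(x;P) > \alpha\}\right),$$ where $\mathrm{cl}$ denotes closure. The Hausdorff distance of compact sets $K,L \subset \mathbb R^d$ is $\delta_H(K,L) = \max\{\sup_{x \in K}\inf_{y \in L}\|x-y\|, \sup_{x \in L}\inf_{y\in K}\|x-y\|\}$. *)

(* Defs.v *)
From HB Require Import structures.
From mathcomp Require Import all_boot all_order all_algebra.
From mathcomp Require Import all_classical all_reals all_analysis.
Import Order.TTheory GRing.Theory Num.Theory.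
Import numFieldNormedType.Exports.

Set Implicit Arguments.
Unset Strict Implicit.
Unset Printing Implicit Defensive.

Local Open Scope classical_set_scope.
Local Open Scope ring_scope.

Definition dotv (R : realType) (d : nat) (x y : 'rV[R]_d) : R :=
  \sum_(i < d) x ord0 i * y ord0 i.

(* The library norm [`|x|] on row vectors is the sup norm, hence this one.
   Both induce the topology that the library puts on ['rV[R]_d]. *)
Definition enorm (R : realType) (d : nat) (x : 'rV[R]_d) : R :=
  Num.sqrt (dotv x x).

Definition sphere (R : realType) (d : nat) : set 'rV[R]_d :=
  [set x | enorm x = 1].

(* R^d with its Borel sigma-algebra. *)
Definition borelRV (R : realType) (d : nat) :=
  g_sigma_algebraType (@open 'rV[R]_d).

(* Borel probability measures on the unit sphere of R^d, represented by their
   extensions to R^d: the Borel subsets of the sphere are the traces of the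
   Borel subsets of R^d, so this is the same data.  (A measurable type of the
   library is pointed, which the sphere type is not when d = 0.) *)
Record sphere_probability (R : realType) (d : nat) := SphereProbability {
  sphere_prob :> probability (borelRV R d) R ;
  sphere_probE : sphere_prob (@sphere R d) = 1%E }.

Definition mass (R : realType) (d : nat) (P : sphere_probability R d)
    (A : set 'rV[R]_d) : R :=
  fine (P (A `&` @sphere R d)).

Definition halfspace0 (R : realType) (d : nat) (u : 'rV[R]_d) : set 'rV[R]_d :=
  [set y | 0 <= dotv y u].

(* For x in the sphere the infimum is over a nonempty set (take u = x) of
   numbers of [0, 1]. *)
Definition ahD (R : realType) (d : nat) (P : sphere_probability R d)
    (x : 'rV[R]_d) : R :=
  inf [set mass P (halfspace0 u) | u in [set u | sphere u /\ halfspace0 u x]].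

Definition ahD_region (R : realType) (d : nat) (P : sphere_probability R d)
    (alpha : R) : set 'rV[R]_d :=
  [set x | sphere x /\ alpha <= ahD P x].

(* Minimum and maximum over the sphere; both are attained when d > 0: ahD is
   upper semicontinuous, and if P(H_{0,u_n}) tends to its infimum over the
   sphere with u_n converging to u, then ahD(u; P) equals that infimum. *)
Definition ahD_min (R : realType) (d : nat) (P : sphere_probability R d) : R :=
  inf [set ahD P x | x in @sphere R d].

Definition ahD_max (R : realType) (d : nat) (P : sphere_probability R d) : R :=
  sup [set ahD P x | x in @sphere R d].

Definition ahD_strictly_monotone (R : realType) (d : nat)
    (P : sphere_probability R d) : Prop :=
  forall alpha : R, ahD_min P < alpha < ahD_max P ->
    ahD_region P alpha = closure [set x | sphere x /\ alpha < ahD P x].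

(* Extended-real valued, so that the distance between an empty set and a
   nonempty one is +oo rather than a default value. *)
Definition hausdorff_dist (R : realType) (d : nat) (K L : set 'rV[R]_d) :
    \bar R :=
  maxe
    (ereal_sup [set ereal_inf [set (enorm (x - y))%:E | y in L] | x in K])
    (ereal_sup [set ereal_inf [set (enorm (x - y))%:E | y in K] | x in L]).

(* Main.v *)
Require Import Defs.
From HB Require Import structures.
From mathcomp Require Import all_boot all_order all_algebra.
From mathcomp Require Import all_classical all_reals all_analysis.
From mathcomp Require Import lra.
Import Order.TTheory GRing.Theory Num.Theory.
Import numFieldNormedType.Exports.

(** Strict monotonicity says that the superlevel sets of [ahD P] vary
    continuously with the level; compactness of the sphere and of [[a, b]]
    makes this uniform.  Precisely, for every [e > 0] there is a single gap
    [r > 0] such that each point [x] of the sphere that nearly reaches a level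
    [c] of [[a, b]], in that [ahD P x >= c - r], is [e]-close to a point [y] of
    the sphere that clears it with margin, [ahD P y >= c + r]
    ([superlevel_gap]).

    Once [ahD (P_ n)] is uniformly within [r] of [ahD P], both halves of the
    Hausdorff distance follow from this one property: a point of either region
    of level [c] has [ahD P x >= c - r], and the [e]-close point [y], where
    [ahD P y >= c + r], belongs to both regions.

    The gap is found locally around each pair [(x, c)]
    ([superlevel_gap_near]).  If [ahD P x < c], then [x] lies outside a
    slightly lower superlevel set, which is closed because it is a closure, so
    that no nearby point nearly reaches a nearby level.  If [ahD P x >= c],
    then [x] is in the closure of the points of depth [> c], and one such
    point serves all pairs near [(x, c)].

    The only facts needed about the depth itself are its bounds [0] and [1]:
    the real supremum in the hypothesis of uniform convergence bounds each
    difference only because these differences form a bounded set. *)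

Local Open Scope classical_set_scope.
Local Open Scope ring_scope.

(** * Superlevel sets of a strictly monotone function *)

(** [D] stands for a distance that need not be the one defining the topology
    of [T]: separate continuity and vanishing on the diagonal suffice.  This
    lets the lemma apply to the Euclidean norm although the topology of row
    vectors comes from the sup norm. *)
Lemma superlevel_gap_near (R : realType) (T : topologicalType) (S : set T)
    (f : T -> R) (D : T -> T -> R) (m b e : R) (x : T) (c : R) :
  (forall y, continuous (D^~ y)) -> (forall y, continuous (D y)) ->
  (forall y, D y y = 0) ->
  (forall t, m < t <= b ->
     [set y | S y /\ t <= f y] = closure [set y | S y /\ t < f y]) ->
  0 < e -> m < c <= b -> S x ->
  exists2 h, 0 < h & nbhs x [set x' | forall c' r : R,
    `|c - c'| < h -> r < h -> S x' -> c' - r <= f x' ->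
    exists y, [/\ S y, D x' y < e & c' + r <= f y]].
Proof.
move=> contDl contDr D0 strict e0 /andP[mc cb] Sx.
have [fxc|cfx] := ltP (f x) c.
(* [t] is a level strictly between [f x] and [c] that is also above [m]; near
   [x] and [c] no point of [S] satisfies the premise. *)
- pose t := Num.max ((f x + c) / 2) ((m + c) / 2).
  have ft : f x < t by rewrite lt_max; apply/orP; left; lra.
  have mt : m < t by rewrite lt_max; apply/orP; right; lra.
  have tc : t < c by rewrite gt_max; apply/andP; split; lra.
  exists ((c - t) / 2); first lra.
  have : nbhs x (~` [set y | S y /\ t <= f y]).
    apply: open_nbhs_nbhs; split; last by case=> _ /=; rewrite leNgt ft.
    apply: closed_openC; rewrite strict; last by apply/andP; split; lra.
    exact: closed_closure.
  apply: filterS => x' nt c' r cc' rh Sx' cfx'; case: nt; split => //.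
  by move: cc'; rewrite ltr_norml => /andP[? ?]; lra.
- have : closure [set y | S y /\ c < f y] x.
    by rewrite -strict //; apply/andP.
  have /[swap]/[apply] : nbhs x (D x @^-1` [set t | t < e]).
    by apply: contDr; apply: lt_nbhsl; rewrite D0.
  move=> [y [[Sy cfy] /= Dxy]].
  exists ((f y - c) / 2); first lra.
  have : nbhs x (D^~ y @^-1` [set t | t < e]).
    by apply: contDl; exact: lt_nbhsl.
  apply: filterS => x' /= Dx' c' r cc' rh _ _; exists y; split => //.
  by move: cc'; rewrite ltr_norml => /andP[? ?]; lra.
Qed.

(** Compactness of [S `*` `[a, b]] turns the local gaps into a common one. *)
Lemma superlevel_gap (R : realType) (T : topologicalType) (S : set T)
    (f : T -> R) (D : T -> T -> R) (m a b e : R) :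
  compact S ->
  (forall y, continuous (D^~ y)) -> (forall y, continuous (D y)) ->
  (forall y, D y y = 0) ->
  (forall t, m < t <= b ->
     [set y | S y /\ t <= f y] = closure [set y | S y /\ t < f y]) ->
  m < a -> 0 < e ->
  exists2 r, 0 < r & forall x c, S x -> a <= c <= b -> c - r <= f x ->
    exists y, [/\ S y, D x y < e & c + r <= f y].
Proof.
move=> cptS contDl contDr D0 strict ma e0.
pose Q r (p : T * R) := S p.1 -> p.2 - r <= f p.1 ->
  exists y, [/\ S y, D p.1 y < e & p.2 + r <= f y].
suff : \forall r \near 0^'+, S `*` `[a, b] `<=` Q r.
  move=> SQ.
  have [r [r0 SQr]] := filter_ex (filterI (nbhs_right_gt (0 : R)) SQ).
  exists r => // x c Sx cab cfx.
  by apply: (SQr (x, c)) => //; split => //=; rewrite in_itv.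
have /compact_near_coveringP : compact (S `*` `[a, b]).
  by apply: compact_setX => //; exact: segment_compact.
apply; move=> [x c] [/= Sx /[!in_itv]/= /andP[ac cb]].
have mcb : m < c <= b by rewrite cb (lt_le_trans ma).
have [h h0 xh] := @superlevel_gap_near R T S f D m b e x c
    contDl contDr D0 strict e0 mcb Sx.
set U : set T := (X in nbhs x X) in xh.
exists (U `*` ball c h, [set r | r < h]) => /=.
  split; last exact: nbhs_right_lt.
  exists (U, ball c h) => //; split => //=.
  exact: nbhsx_ballx.
by move=> [[x' c'] r] [[/= Ux' cc'] rh]; exact: Ux'.
Qed.

(** * The unit sphere *)

Lemma dotv_continuous (R : realType) (d : nat) (T : topologicalType)
    (f g : T -> 'rV[R]_d) :
  continuous f -> continuous g -> continuous (fun x => dotv (f x) (g x)).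
Proof.
move=> cf cg; apply: continuous_big; first exact: add_continuous.
have coord (h : T -> 'rV[R]_d) (i : 'I_d) :
    continuous h -> continuous (fun x => h x ord0 i).
  move=> ch x; apply: (@continuous_comp _ _ _ h (fun M : 'rV[R]_d => M ord0 i)).
    exact: ch.
  exact: coord_continuous.
move=> i _ x; apply: cvgM; exact: coord.
Qed.

Lemma enorm_continuous (R : realType) (d : nat) : continuous (@enorm R d).
Proof.
move=> x; apply: (@continuous_comp _ _ _ (fun y => dotv y y) Num.sqrt).
  by apply: dotv_continuous => y; exact: cvg_id.
exact: sqrt_continuous.
Qed.

Lemma enormBl_continuous (R : realType) (d : nat) (y : 'rV[R]_d) :
  continuous (fun x : 'rV[R]_d => enorm (x - y)).
Proof.
move=> x.
have xy : z - y @[z --> x] --> x - y.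
  exact: (cvgB cvg_id (cvg_cst _)).
exact: (cvg_comp _ _ xy (@enorm_continuous R d (x - y))).
Qed.

Lemma enormBr_continuous (R : realType) (d : nat) (x : 'rV[R]_d) :
  continuous (fun y : 'rV[R]_d => enorm (x - y)).
Proof.
move=> y.
have xy : x - z @[z --> y] --> x - y.
  exact: (cvgB (cvg_cst _) cvg_id).
exact: (cvg_comp _ _ xy (@enorm_continuous R d (x - y))).
Qed.

Lemma sphere_closed (R : realType) (d : nat) : closed (@sphere R d).
Proof.
apply: (@preimage_closed _ _ (@enorm R d) [set x | x = 1]).
  by move=> x _; exact: enorm_continuous.
exact: closed_eq.
Qed.

Lemma halfspace0_closed (R : realType) (d : nat) (u : 'rV[R]_d) :
  closed (halfspace0 u).
Proof.
apply: (@preimage_closed _ _ (fun y => dotv y u) [set x | 0 <= x]).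
  move=> x _; apply: (@dotv_continuous _ _ _ id (cst u)) => y.
    exact: cvg_id.
  exact: cst_continuous.
exact: closed_ge.
Qed.

Lemma sphere_compact (R : realType) (d : nat) : compact (@sphere R d).
Proof.
apply: bounded_closed_compact; last exact: sphere_closed.
exists 1; split => // M M1 x; rewrite /sphere/= /enorm => x1.
have xx1 : dotv x x = 1.
  have dot0 : 0 <= dotv x x by apply: sumr_ge0 => i _; rewrite -expr2 sqr_ge0.
  by rewrite -(sqr_sqrtr dot0) x1 expr1n.
apply: (le_trans _ (ltW M1)).
rewrite [leLHS]mx_normrE; apply: bigmax_le => // -[i j] _ /=.
rewrite ord1 -(@ler_pXn2r _ 2) ?nnegrE // expr1n real_normK ?num_real //.
rewrite -xx1 /dotv (bigD1 j) //= expr2 lerDl.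
by apply: sumr_ge0 => k _; rewrite -expr2 sqr_ge0.
Qed.

(** * The angular halfspace depth *)

(** The upper bound rests on monotonicity of the measure, hence on the
    measurability of the half-sphere, which is closed. *)
Lemma mass_halfspace0_bounds {R : realType} {d : nat} (P : sphere_probability R d)
    (u : 'rV[R]_d) : 0 <= mass P (halfspace0 u) <= 1.
Proof.
have closed_measurable (A : set (borelRV R d)) :
    closed (A : set 'rV[R]_d) -> measurable A.
  move=> cA; rewrite -[A]setCK; apply: measurableC.
  by apply: sub_sigma_algebra; exact: closed_openC.
rewrite /mass fine_ge0 //= -lee_fin fineK; last first.
  by rewrite fin_num_measure//; apply: measurableI; apply: closed_measurable;
    [exact: halfspace0_closed|exact: sphere_closed].
apply: probability_le1; apply: measurableI; apply: closed_measurable.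
  exact: halfspace0_closed.
exact: sphere_closed.
Qed.

Lemma ahD_bounds {R : realType} {d : nat} (P : sphere_probability R d)
    {x : 'rV[R]_d} : sphere x -> 0 <= ahD P x <= 1.
Proof.
move=> Sx; set E := [set mass P (halfspace0 u) |
  u in [set u | sphere u /\ halfspace0 u x]].
have lbE : lbound E 0.
  by move=> _ [u _ <-]; case/andP: (mass_halfspace0_bounds P u).
(* [x] lies in its own halfspace, so the infimum is over a nonempty set. *)
have Ex : E (mass P (halfspace0 x)).
  exists x => //; split => //; apply: sumr_ge0 => i _.
  by rewrite -expr2 sqr_ge0.
apply/andP; split; first by apply: lb_le_inf => //; exists (mass P (halfspace0 x)).
case/andP: (mass_halfspace0_bounds P x) => _; apply: le_trans.
by apply: ge_inf => //; exists 0.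
Qed.

Lemma ahD_dist_le_sup (R : realType) (d : nat) (P Q : sphere_probability R d)
    (x : 'rV[R]_d) : sphere x ->
  `|ahD P x - ahD Q x| <= sup [set `|ahD P y - ahD Q y| | y in @sphere R d].
Proof.
move=> Sx; apply: ub_le_sup; last by exists x.
exists 1 => _ [y Sy <-].
have /andP[P0 P1] := ahD_bounds P Sy.
have /andP[Q0 Q1] := ahD_bounds Q Sy.
by rewrite ler_norml; apply/andP; split; lra.
Qed.

(** * The Hausdorff distance and convergence to zero *)

Lemma hausdorff_dist_le (R : realType) (d : nat) (K L : set 'rV[R]_d) (e : R) :
  (forall x, K x -> exists2 y, L y & enorm (x - y) <= e) ->
  (forall x, L x -> exists2 y, K y & enorm (x - y) <= e) ->
  (hausdorff_dist K L <= e%:E)%E.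
Proof.
move=> KL LK; rewrite /hausdorff_dist ge_max; apply/andP; split;
  apply: ge_ereal_sup => _ [x + <-].
- move=> /KL[y Ly xy]; apply: (@le_trans _ _ (enorm (x - y))%:E) => //.
  by apply: ereal_inf_lbound; exists y.
- move=> /LK[y Ky xy]; apply: (@le_trans _ _ (enorm (x - y))%:E) => //.
  by apply: ereal_inf_lbound; exists y.
Qed.

(** The distance between two empty sets is the supremum of the empty set,
    [-oo]; this is why one of the sets must have a point. *)
Lemma hausdorff_dist_ge0 (R : realType) (d : nat) (K L : set 'rV[R]_d) :
  L !=set0 -> (0 <= hausdorff_dist K L)%E.
Proof.
move=> [x Lx]; rewrite /hausdorff_dist le_max; apply/orP; right.
apply: le_ereal_sup_tmp.
exists (ereal_inf [set (enorm (x - y))%:E | y in K]); first by exists x.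
by apply: le_ereal_inf_tmp => _ [y _ <-]; rewrite lee_fin sqrtr_ge0.
Qed.

Lemma ge0_cvge0 (R : realType) (u : nat -> \bar R) :
  (forall n, (0 <= u n)%E) ->
  (forall e : R, 0 < e -> \forall n \near \oo, (u n <= e%:E)%E) ->
  u @ \oo --> 0%E.
Proof.
move=> u0 ule; apply/fine_cvgP; split.
  apply: filterS (ule 1 ltr01) => n un1.
  by rewrite ge0_fin_numE // (le_lt_trans un1) // ltry.
apply/cvgr0Pnorm_le => e e0; apply: filterS (ule e e0) => n une.
rewrite /= ger0_norm ?fine_ge0 // -lee_fin fineK //.
by rewrite ge0_fin_numE // (le_lt_trans une) // ltry.
Qed.

(** * Uniform convergence of the central regions *)

Theorem theorem11 (R : realType) (d : nat) (d_ge2 : (2 <= d)%N)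
    (P : sphere_probability R d) (P_ : nat -> sphere_probability R d)
    (P_mono : ahD_strictly_monotone P)
    (P_unif : sup [set `|ahD (P_ n) x - ahD P x| | x in @sphere R d]
                @[n --> \oo] --> (0 : R))
    (a b : R) (ab : a <= b)
    (abP : `[a, b] `<=` `]ahD_min P, ahD_max P[) :
  ereal_sup [set hausdorff_dist (ahD_region (P_ n) alpha) (ahD_region P alpha)
            | alpha in `[a, b]] @[n --> \oo] --> (0 : \bar R)%E.
Proof.
have /andP[ma _] : ahD_min P < a < ahD_max P.
  by have := abP a; rewrite /= !in_itv /= lexx ab; apply.
have /andP[_ bM] : ahD_min P < b < ahD_max P.
  by have := abP b; rewrite /= !in_itv /= lexx ab; apply.
have [x0 Sx0 bx0] : exists2 x, sphere x & b < ahD P x.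
  have [|_ [x Sx <-] bx] := sup_gt _ bM; last by exists x.
  apply/set0P/eqP => E0.
  (* over an empty sphere the minimum and the maximum would both be [0] *)
  by move: (lt_trans ma (le_lt_trans ab bM)); rewrite /ahD_min /ahD_max E0
    sup0 inf0 ltxx.
apply: ge0_cvge0 => [n|e e0].
  apply: le_ereal_sup_tmp.
  exists (hausdorff_dist (ahD_region (P_ n) a) (ahD_region P a)).
    by exists a => //=; rewrite in_itv /= lexx ab.
  apply: hausdorff_dist_ge0; exists x0; split => //.
  by rewrite (le_trans ab) // ltW.
have strict t : ahD_min P < t <= b ->
    [set y | sphere y /\ t <= ahD P y] =
    closure [set y | sphere y /\ t < ahD P y].
  by move=> /andP[mt tb]; apply: P_mono; rewrite mt (le_lt_trans tb).
have enormB0 (y : 'rV[R]_d) : enorm (y - y) = 0.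
  rewrite subrr /enorm /dotv big1 ?sqrtr0 // => i _.
  by rewrite mxE mul0r.
have [r r0 gap] := @superlevel_gap R _ _ (ahD P) (fun x y => enorm (x - y))
  _ a b e (@sphere_compact R d) (@enormBl_continuous R d)
  (@enormBr_continuous R d) enormB0 strict ma e0.
have /cvgr0Pnorm_lt/(_ r r0) := P_unif; apply: filterS => n /=.
move=> /(le_lt_trans (ler_norm _)) supr.
have close x : sphere x -> `|ahD (P_ n) x - ahD P x| < r.
  by move=> Sx; exact: le_lt_trans (ahD_dist_le_sup _ _ _ _ _ Sx) supr.
apply: ge_ereal_sup => _ [c /= /[!in_itv]/= cab <-].
apply: hausdorff_dist_le => x [Sx cx].
- have [|y [Sy xy cy]] := gap x c Sx cab.
    by have := close x Sx; rewrite ltr_norml => /andP[? ?]; lra.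
  by exists y; [split => //; lra|exact: ltW].
- have [|y [Sy xy cy]] := gap x c Sx cab; first lra.
  exists y; last exact: ltW.
  by split => //; have := close y Sy; rewrite ltr_norml => /andP[? ?]; lra.
Qed.
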